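(* The proof system $\mathbf{EN}^\circ$ is sound and strongly complete with respect to the class of $(n)$-frames.
   Context: Fix a nonempty set $\mathbf{P}$ of propositional variables, $p\in\mathbf{P}$. $\mathcal{L}(\bullet)$: $\varphi::=p\mid\neg\varphi\mid\varphi\land\varphi\mid\bullet\varphi$; other Boolean connectives (including $\top$) are defined as usual and $\circ\varphi$ abbreviates $\neg\bullet\varphi$. A neighborhood frame is $\langle S,N\rangle$ with $S$ a nonempty set and $N:S\to\mathcal{P}(\mathcal{P}(S))$; a model $\mathcal{M}=\langle S,N,V\rangle$ based on it adds $V:\mathbf{P}\to\mathcal{P}(S)$. With $\varphi^{\mathcal{M}}=\{s\in S\mid\mathcal{M},s\vDash\varphi\}$: $\mathcal{M},s\vDash p$ iff $s\in V(p)$; Boolean connectives as usual; $\mathcal{M},s\vDash\bullet\varphi$ iff $s\in\varphi^{\mathcal{M}}$ and $\varphi^{\mathcal{M}}\notin N(s)$. An $(n)$-frame is one where $S\in N(s)$ for all $s\in S$. The proof system $\mathbf{EN}^\circ$ for $\mathcal{L}(\bullet)$ has as axioms all instances of propositional tautologies, all instances of $\circ\texttt{E}$: $\bullet\varphi\to\varphi$, and $\circ\texttt{N}$: $\circ\top$; its rules are modus ponens and $\texttt{RE}\circ$: from $\varphi\leftrightarrow\psi$ infer $\circ\varphi\leftrightarrow\circ\psi$ (applied to theorems). Sound with respect to a class of frames: every theorem is true at every state of every model based on a frame in the class. Strongly complete: for every set $\Gamma\cup\{\varphi\}$ of formulas, if $\varphi$ is true at every state, in every model based on a frame in the class, at which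 all of $\Gamma$ is true, then $\vdash\bigwedge\Gamma_0\to\varphi$ for some finite $\Gamma_0\subseteq\Gamma$ (equivalently, every consistent set is satisfiable in a model based on a frame in the class). *)

(* Defs.v *)
From Stdlib Require List.
From mathcomp Require Import all_boot.
From mathcomp Require Import boolp classical_sets.

Set Implicit Arguments.
Unset Strict Implicit.
Unset Printing Implicit Defensive.

Local Open Scope classical_set_scope.

Inductive form (P : Type) : Type :=
| Var of P
| Neg of form P
| And of form P & form P
| Bul of form P.

Definition Imp (P : Type) (phi psi : form P) : form P := Neg (And phi (Neg psi)).
Definition Iff (P : Type) (phi psi : form P) : form P :=
  And (Imp phi psi) (Imp psi phi).
Definition Circ (P : Type) (phi : form P) : form P := Neg (Bul phi).

(* The language has no primitive constant: the verum is p0 -> p0 for a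
   designated variable p0, which exists because the set of variables is
   nonempty. *)
Definition Top (P : Type) (p0 : P) : form P := Imp (Var p0) (Var p0).

Definition bigAnd (P : Type) (p0 : P) (G : seq (form P)) : form P :=
  foldr (@And P) (Top p0) G.

Record frame : Type := Frame {
  world :> Type;
  world_inhabited : inhabited world;
  nbhd : world -> set (set world)
}.

Record model (P : Type) : Type := Model {
  model_frame :> frame;
  valuation : P -> set model_frame
}.

Fixpoint sat (P : Type) (M : model P) (s : M) (phi : form P) {struct phi} : Prop :=
  match phi with
  | Var p => valuation p s
  | Neg psi => ~ sat s psi
  | And psi chi => sat s psi /\ sat s chi
  | Bul psi => sat s psi /\ ~ nbhd s [set t : M | sat t psi]
  end.

Definition n_frame (F : frame) : Prop := forall s : F, nbhd s setT.

(* Propositional schemata use their own countable supply of letters, since P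
   may be finite; an instance of a tautology is a substitution instance of a
   schema true under all Boolean assignments. *)
Inductive pform : Type :=
| PVar of nat
| PNeg of pform
| PAnd of pform & pform.

Fixpoint peval (v : nat -> bool) (a : pform) : bool :=
  match a with
  | PVar i => v i
  | PNeg b => ~~ peval v b
  | PAnd b c => peval v b && peval v c
  end.

Definition tautology (a : pform) : Prop := forall v : nat -> bool, peval v a.

Fixpoint psubst (P : Type) (sigma : nat -> form P) (a : pform) : form P :=
  match a with
  | PVar i => sigma i
  | PNeg b => Neg (psubst sigma b)
  | PAnd b c => And (psubst sigma b) (psubst sigma c)
  end.

Inductive EN_circ (P : Type) (p0 : P) : form P -> Prop :=
| EN_taut (a : pform) (sigma : nat -> form P) :
    tautology a -> EN_circ p0 (psubst sigma a)
| EN_circE (phi : form P) : EN_circ p0 (Imp (Bul phi) phi)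
| EN_circN : EN_circ p0 (Circ (Top p0))
| EN_MP (phi psi : form P) :
    EN_circ p0 (Imp phi psi) -> EN_circ p0 phi -> EN_circ p0 psi
| EN_RE (phi psi : form P) :
    EN_circ p0 (Iff phi psi) -> EN_circ p0 (Iff (Circ phi) (Circ psi)).

Definition sound (P : Type) (L : form P -> Prop) (C : frame -> Prop) : Prop :=
  forall phi : form P, L phi ->
  forall M : model P, C M -> forall s : M, sat s phi.

Definition entails (P : Type) (C : frame -> Prop) (Gamma : set (form P))
    (phi : form P) : Prop :=
  forall M : model P, C M ->
  forall s : M, (forall psi, Gamma psi -> sat s psi) -> sat s phi.

Definition strongly_complete (P : Type) (p0 : P) (L : form P -> Prop)
    (C : frame -> Prop) : Prop :=
  forall (Gamma : set (form P)) (phi : form P),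
    entails C Gamma phi ->
    exists G : seq (form P),
      [set psi | List.In psi G] `<=` Gamma /\ L (Imp (bigAnd p0 G) phi).

(* Main.v *)
Require Import Defs.
From Stdlib Require List.
From mathcomp Require Import all_boot.
From mathcomp Require Import boolp classical_sets.

Set Implicit Arguments.
Unset Strict Implicit.
Unset Printing Implicit Defensive.

Local Open Scope classical_set_scope.

(** Completeness is by a canonical model on the maximal consistent sets, with
    [|phi|] a neighborhood of [A] exactly when [Circ phi] belongs to [A].  If
    [|phi| = |psi|] then [phi <-> psi] is a theorem, so by the rule RE this does
    not depend on the formula representing [|phi|]; the truth lemma for [Bul]
    follows with the axiom [Bul phi -> phi].  As [|Top|] is the whole space and
    [Circ Top] is an axiom, the canonical frame is an (n)-frame. *)

Section Completeness.
Variables (P : Type) (p0 : P).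
Implicit Types (phi psi chi : form P) (u : form P -> bool).
Implicit Types (A B Gamma : set (form P)) (G : seq (form P)).

Local Notation thm := (EN_circ p0).

(** * Propositional reasoning inside the proof system *)

(* Boolean evaluation in which variables and [Bul]-formulas are atomic. *)
Fixpoint beval u phi : bool :=
  match phi with
  | Neg psi => ~~ beval u psi
  | And psi chi => beval u psi && beval u chi
  | _ => u phi
  end.

Fixpoint reify (e : form P -> nat) phi : pform :=
  match phi with
  | Neg psi => PNeg (reify e psi)
  | And psi chi => PAnd (reify e psi) (reify e chi)
  | _ => PVar (e phi)
  end.

(** The type [{classic form P}] supplies the decidable equality behind [index] and list membership,
    as [P] is an arbitrary type. *)
Fixpoint atoms phi : seq {classic form P} :=
  match phi with
  | Neg psi => atoms psi
  | And psi chi => atoms psi ++ atoms chi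
  | _ => [:: phi]
  end.

Lemma peval_reify e (v : nat -> bool) phi :
  peval v (reify e phi) = beval (v \o e) phi.
Proof. by elim: phi => //= [psi ->|psi -> chi ->]. Qed.

Lemma psubst_reify e (sigma : nat -> form P) phi :
  {in atoms phi, forall a, sigma (e a) = a} -> psubst sigma (reify e phi) = phi.
Proof.
elim: phi => [p|psi IH|psi IHpsi chi IHchi|psi _] /= H.
- by apply: H; rewrite inE.
- by rewrite IH.
- by rewrite IHpsi ?IHchi // => a a_in; apply: H; rewrite mem_cat a_in ?orbT.
- by apply: H; rewrite inE.
Qed.

(** Coding each atom by its position in [atoms phi] turns [phi] into a schema that is a tautology;
    substituting the atoms back for their positions recovers [phi]. *)
Lemma thm_taut phi : (forall u, beval u phi) -> thm phi.
Proof.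
move=> H.
pose e (a : form P) := index (a : {classic form P}) (atoms phi).
have <- : psubst (fun i => nth (phi : {classic form P}) (atoms phi) i)
            (reify e phi) = phi.
  by apply: psubst_reify => a; exact: nth_index.
by apply: EN_taut => v; rewrite peval_reify.
Qed.

Lemma thm_conseq phi psi :
  (forall u, beval u phi -> beval u psi) -> thm phi -> thm psi.
Proof.
move=> H; apply: EN_MP; apply: thm_taut => u /=; rewrite negb_and negbK.
by case E: (beval u phi) => //=; exact: H.
Qed.

Lemma thm_and phi psi : thm phi -> thm psi -> thm (And phi psi).
Proof.
move=> Hphi; apply: EN_MP; move: Hphi; apply: EN_MP; apply: thm_taut => u /=.
by case: (beval u phi); case: (beval u psi).
Qed.

Lemma beval_imp u phi psi :
  beval u (Imp phi psi) = (beval u phi ==> beval u psi).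
Proof. by rewrite /= negb_and negbK implybE. Qed.

Lemma beval_and u phi psi :
  beval u (And phi psi) = beval u phi && beval u psi.
Proof. by []. Qed.

Lemma beval_bigAnd u G :
  beval u (bigAnd p0 G) <-> forall psi, List.In psi G -> beval u psi.
Proof.
elim: G => [|phi G IH]; first by rewrite [bigAnd _ _]/= beval_imp implybb.
split=> [/= /andP[Hphi /IH HG] psi [<-//|]|H /=]; first exact: HG.
by apply/andP; split; [apply: H; left | apply/IH => psi ?; apply: H; right].
Qed.

(** * Derivability from a set of formulas *)

Definition derives A phi : Prop :=
  exists G, [set psi | List.In psi G] `<=` A /\ thm (Imp (bigAnd p0 G) phi).

Lemma derives_thm A phi : thm phi -> derives A phi.
Proof.
move=> H; exists [::]; split=> //; apply: thm_conseq H => u.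
by rewrite beval_imp => ->; rewrite implybT.
Qed.

Lemma derives_hyp A phi : A phi -> derives A phi.
Proof.
move=> H; exists [:: phi]; split=> [psi [<-|]//|].
by apply: thm_taut => u; rewrite beval_imp; apply/implyP => /andP[].
Qed.

Lemma derives_and A phi psi :
  derives A phi -> derives A psi -> derives A (And phi psi).
Proof.
move=> [G [GA HG]] [G' [GA' HG']]; exists (G ++ G'); split.
  by move=> chi /List.in_app_iff[/GA|/GA'].
apply: thm_conseq (thm_and HG HG') => u.
rewrite beval_and !beval_imp => /andP[/implyP H /implyP H'].
apply/implyP => /beval_bigAnd HGG' /=.
by rewrite H ?H' //; apply/beval_bigAnd => chi chiG;
  apply: HGG'; apply/List.in_app_iff; [right|left].
Qed.

Lemma derives_conseq A phi psi :
  (forall u, beval u phi -> beval u psi) -> derives A phi -> derives A psi.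
Proof.
move=> H [G [GA HG]]; exists G; split=> //; apply: thm_conseq HG => u.
by rewrite !beval_imp => /implyP HG; apply/implyP => /HG /H.
Qed.

Lemma derives_mp A phi psi :
  derives A (Imp phi psi) -> derives A phi -> derives A psi.
Proof.
move=> H1 H2; apply: derives_conseq (derives_and H1 H2) => u.
by rewrite beval_and beval_imp => /andP[/implyP].
Qed.

(** The list [G'] arises from [G] by keeping the entries that lie in [A] and dropping the others,
    all equal to [phi]; together with [phi] its conjunction implies that of [G]. *)
Lemma derives_deduction A phi psi :
  derives (A `|` [set phi]) psi -> derives A (Imp phi psi).
Proof.
move=> [G [GA HG]].
suff [G' [GA' HG']] : exists G', [set chi | List.In chi G'] `<=` A /\
    forall u, beval u phi -> beval u (bigAnd p0 G') -> beval u (bigAnd p0 G).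
  exists G'; split=> //; apply: thm_conseq HG => u; rewrite !beval_imp.
  by move=> /implyP H; apply/implyP => uG'; apply/implyP => uphi; apply/H/HG'.
elim: G GA {HG} => [|chi G IH] GA; first by exists [::]; split.
have [|G' [GA' HG']] := IH; first by move=> c ?; apply: GA; right.
have [Achi|->] : (A `|` [set phi]) chi by apply: GA; left.
- exists (chi :: G'); split=> [c [<-//|]|u uphi /= /andP[->]]; first exact: GA'.
  exact: HG'.
- by exists G'; split=> // u uphi /(HG' _ uphi) /= ->; rewrite uphi.
Qed.

Lemma thm_of_derives1 phi psi : derives [set phi] psi -> thm (Imp phi psi).
Proof.
rewrite -[[set phi]]set0U => /derives_deduction[[|chi G] [G0]].
  by apply: thm_conseq => u; rewrite !beval_imp implybb.
by have [] : set0 chi by apply: G0; left.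
Qed.

(** * Maximal consistent sets *)

Definition mcs A : Prop :=
  (forall phi, derives A phi -> A phi) /\ (forall phi, A (Neg phi) <-> ~ A phi).

(** A finite list draws on finitely many members of the chain, and the largest of them suffices;
    [set0] covers the case where none is used. *)
Lemma seq_sub_chain Gamma (F : set (set (form P))) G :
  total_on F subset ->
  [set psi | List.In psi G] `<=` Gamma `|` \bigcup_(X in F) X ->
  exists2 X, X = set0 \/ F X & [set psi | List.In psi G] `<=` Gamma `|` X.
Proof.
move=> Ftot; elim: G => [|chi G IH] GF; first by exists set0; [left|].
have [|X FX GX] := IH; first by move=> c ?; apply: GF; right.
have [Gchi|[Y FY Ychi]] := GF chi (or_introl erefl).
  by exists X => // c [<-|/GX//]; left.
have [XY|YX] : X `<=` Y \/ Y `<=` X.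
  by case: FX => [->|FX]; [left|exact: Ftot].
- by exists Y; [right|move=> c [<-|/GX[|/XY]]; [right|left|right]].
- by exists X => // c [<-|/GX//]; right; exact: YX.
Qed.

Lemma lindenbaum Gamma phi :
  ~ derives Gamma phi -> exists A, [/\ mcs A, Gamma `<=` A & ~ A phi].
Proof.
move=> nGphi.
(* The union with [Gamma] makes the empty chain harmless. *)
have [|B [nBphi Bmax]] :=
    @Zorn_bigcup _ [set X | ~ derives (Gamma `|` X) phi].
  move=> F FP Ftot [G [GF HG]].
  have [X [->|FX] GX] := seq_sub_chain Ftot GF.
    by apply: nGphi; exists G; rewrite setU0 in GX.
  by apply: (FP X FX); exists G.
set A := Gamma `|` B in nBphi.
(* A formula outside [A] would properly enlarge [B], so by maximality adding it makes [phi]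
   derivable. *)
have Amax psi : ~ A psi -> derives A (Imp psi phi).
  move=> nApsi; apply: derives_deduction; apply: contrapT; rewrite -setUA.
  apply: Bmax; split=> [|sub]; last by apply: nApsi; right; apply: sub; right.
  exact: subsetUl.
have Acl psi : derives A psi -> A psi.
  by move=> Apsi; apply: contrapT => /Amax /derives_mp /(_ Apsi).
exists A; split; [split=> // psi|exact: subsetUl|by move/derives_hyp].
(* Consistency: a contradictory pair in [A] would derive [phi]. *)
split=> [/derives_hyp An /derives_hyp Ap|/Amax Ap].
  apply: nBphi; apply: derives_conseq (derives_and An Ap) => u /=.
  by case: (beval u psi).
(* Completeness: if both [psi] and its negation were missing, [phi] would follow from [A] by
   cases. *)
apply: contrapT => /Amax An; apply: nBphi.
apply: derives_conseq (derives_and An Ap) => u; rewrite beval_and !beval_imp /=.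
by case: (beval u psi) => //= /andP[].
Qed.

Section McsTheory.
Variables (A : set (form P)) (mA : mcs A).

Lemma mcs_neg phi : A (Neg phi) <-> ~ A phi.
Proof. by case: mA. Qed.

Lemma mcs_thm phi : thm phi -> A phi.
Proof. by move=> H; apply: (proj1 mA); exact: derives_thm. Qed.

Lemma mcs_mp phi psi : thm (Imp phi psi) -> A phi -> A psi.
Proof.
move=> H Aphi; apply: (proj1 mA).
exact: derives_mp (derives_thm A H) (derives_hyp Aphi).
Qed.

Lemma mcs_and phi psi : A (And phi psi) <-> A phi /\ A psi.
Proof.
split=> [|[Aphi Apsi]]; last first.
  by apply: (proj1 mA); apply: derives_and; exact: derives_hyp.
by split; apply: mcs_mp H; apply: thm_taut => u; rewrite beval_imp;
  apply/implyP => /andP[].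
Qed.

End McsTheory.

(** * The canonical model *)

Definition canonical_world : Type := {A : set (form P) | mcs A}.

Definition truth_set phi : set canonical_world := [set A | sval A phi].

(** Otherwise [psi] is not derivable from [phi] alone, and a Lindenbaum extension of the singleton
    contains [phi] but omits [psi]. *)
Lemma truth_set_sub_thm phi psi :
  truth_set phi `<=` truth_set psi -> thm (Imp phi psi).
Proof.
move=> sub; apply: thm_of_derives1; apply: contrapT => /lindenbaum[A [mA Aphi]].
by apply; apply: (sub (exist _ A mA)); exact: Aphi.
Qed.

Lemma truth_set_inj_circ (A : canonical_world) phi psi :
  truth_set phi = truth_set psi -> sval A (Circ phi) -> sval A (Circ psi).
Proof.
move=> eq_ts; apply: (mcs_mp (svalP A)).
have thm_iff : thm (Iff phi psi).
  by apply: thm_and; apply: truth_set_sub_thm; rewrite eq_ts.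
by apply: thm_conseq (EN_RE thm_iff) => u; rewrite beval_and => /andP[].
Qed.

Definition canonical_nbhd (A : canonical_world) : set (set canonical_world) :=
  [set X | exists2 phi, X = truth_set phi & sval A (Circ phi)].

(** The parameter [A0] provides the inhabitant that a frame requires. *)
Definition canonical_model (A0 : canonical_world) : model P :=
  @Model P (Frame (inhabits A0) canonical_nbhd)
    (fun p => truth_set (Var p)).

Lemma n_frame_canonical (A0 : canonical_world) : n_frame (canonical_model A0).
Proof.
move=> A; exists (Top p0); last exact: (mcs_thm (svalP A) (EN_circN p0)).
apply/seteqP; split=> // B _; apply: (mcs_thm (svalP B)).
by apply: thm_taut => u; rewrite beval_imp implybb.
Qed.

Lemma truth_lemma (A0 : canonical_world) phi (A : canonical_model A0) :
  sat A phi <-> sval A phi.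
Proof.
elim: phi A => [p|psi IH|psi IHpsi chi IHchi|psi IH] A /=.
- by [].
- by rewrite (mcs_neg (svalP A)) IH.
- by rewrite (mcs_and (svalP A)) IHpsi IHchi.
have -> : [set t : canonical_model A0 | sat t psi] = truth_set psi.
  by apply/seteqP; split=> B /IH.
split=> [[/IH Apsi nN]|ABul].
  (* If [Bul psi] were missing from [A], then [Circ psi] would be in [A] and make the truth set of
     [psi] a neighborhood. *)
  by apply: contrapT => /(mcs_neg (svalP A)) nB; apply: nN; exists psi.
split; first by apply/IH; exact: (mcs_mp (svalP A) (EN_circE p0 psi) ABul).
(* The neighborhood may be represented by another formula [chi]; [Circ chi] in [A] yields [Circ psi]
   in [A], against [Bul psi]. *)
case=> chi eq_ts /(truth_set_inj_circ (esym eq_ts)).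
by move/(mcs_neg (svalP A)).
Qed.

Lemma EN_circ_complete : strongly_complete p0 thm n_frame.
Proof.
(* The goal unfolds to [derives Gamma phi], so its failure gives a canonical world that refutes the
   entailment. *)
move=> Gamma phi ent; apply: contrapT => /lindenbaum[A [mA GA nA]].
pose A0 : canonical_world := exist _ A mA.
apply: nA; apply/(@truth_lemma A0 phi A0).
apply: ent; first exact: n_frame_canonical.
by move=> psi /GA Apsi; apply/truth_lemma.
Qed.

End Completeness.

(** * Soundness *)

Lemma sat_imp (P : Type) (M : model P) (s : M) (phi psi : form P) :
  sat s (Imp phi psi) <-> (sat s phi -> sat s psi).
Proof.
split=> /= [H sphi|H [sphi]]; last by apply; exact: H.
by apply: contrapT => npsi; exact: H.
Qed.

(** Truth at a fixed state is a Boolean assignment to the schema letters, so every instance of a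
    tautology holds there. *)
Lemma sat_psubst (P : Type) (M : model P) (s : M) (sigma : nat -> form P) a :
  peval (fun i => `[< sat s (sigma i) >]) a <-> sat s (psubst sigma a).
Proof.
elim: a => /= [i|a IH|a IHa b IHb]; first by split=> /asboolP.
  by rewrite -IH; split=> /negP.
by rewrite -IHa -IHb; split=> /andP.
Qed.

Lemma EN_circ_sound (P : Type) (p0 : P) : sound (EN_circ p0) n_frame.
Proof.
move=> phi; elim=> {phi} [a sigma taut|phi||phi psi _ IH1 _ IH2|phi psi _ IH]
  M nM s.
- exact/sat_psubst/taut.
- by apply/sat_imp => -[].
- move=> [_]; apply; have -> : [set t : M | sat t (Top p0)] = setT.
    by apply/seteqP; split=> // t _; apply/sat_imp.
  exact: nM.
- by have /sat_imp := IH1 M nM s; apply; exact: IH2.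
(* The induction hypothesis holds at all states of [M], so the two formulas have the same truth set,
   and neighborhoods see only that set. *)
have eqset : [set t : M | sat t phi] = [set t : M | sat t psi].
  by apply/seteqP; split=> t; have [/sat_imp ? /sat_imp ?] := IH M nM t.
have sat_iff : sat s phi <-> sat s psi.
  by have [/sat_imp ? /sat_imp ?] := IH M nM s.
by split; apply/sat_imp => /=; rewrite eqset sat_iff.
Qed.

Theorem theorem5p8 (P : Type) (p0 : P) :
  sound (EN_circ p0) n_frame /\
  strongly_complete p0 (EN_circ p0) n_frame.
Proof. by split; [exact: EN_circ_sound | exact: EN_circ_complete]. Qed.
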